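(* Let $\mathfrak t$ be a semibounded sesquilinear form in a complex Hilbert space $\mathfrak H$, let $c\le m(\mathfrak t)$, and let $Q_c$ be a representing map for $\mathfrak t-c$, i.e. a linear operator from $\mathfrak H$ to a Hilbert space $\mathfrak K$ with $$\mathfrak t[\varphi,\psi]=c(\varphi,\psi)+(Q_c\varphi,Q_c\psi),\qquad\varphi,\psi\in\operatorname{dom}Q_c=\operatorname{dom}\mathfrak t.$$ Let $Q_{c,\rm reg}=(I-P)Q_c$, where $P$ is the orthogonal projection in $\mathfrak K$ onto $\operatorname{mul}Q_c^{**}$, and let $\mathfrak r=\mathfrak t_{\rm reg}$, so that $\mathfrak r$ is the closable form $$\mathfrak r[\varphi,\psi]=c(\varphi,\psi)+(Q_{c,\rm reg}\varphi,Q_{c,\rm reg}\psi),\qquad\varphi,\psi\in\operatorname{dom}\mathfrak r=\operatorname{dom}\mathfrak t,$$ with closure $\bar{\mathfrak r}[\varphi,\psi]=c(\varphi,\psi)+((Q_{c,\rm reg})^{**}\varphi,(Q_{c,\rm reg})^{**}\psi)$, $\varphi,\psi\in\operatorname{dom}\bar{\mathfrak r}=\operatorname{dom}(Q_{c,\rm reg})^{**}$. Then the relations $S_{\mathfrak r}$ and $\widetilde A_{\mathfrak r}$ are given by $$S_{\mathfrak r}=(Q_{c,\rm reg})^*Q_{c,\rm reg}+c\quad\text{and}\quad\widetilde A_{\mathfrak r}=(Q_{c,\rm reg})^*(Q_{c,\rm reg})^{**}+c,$$ and they satisfy $$S_{\mathfrak t}\subset S_{\mathfrak r}\quad\text{and}\quad\widetilde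 A_{\mathfrak t}=\widetilde A_{\mathfrak r}=A_{\bar{\mathfrak r}}.$$ In particular, the relations $S_{\mathfrak r}$ and $A_{\bar{\mathfrak r}}$ do not depend on the choice of $c\le m(\mathfrak t)$ and the representing map $Q_c$.
   Context: A (sesquilinear) form $\mathfrak t$ in $\mathfrak H$ is a map $\operatorname{dom}\mathfrak t\times\operatorname{dom}\mathfrak t\to\mathbb C$, linear in the first and antilinear in the second entry, where $\operatorname{dom}\mathfrak t$ is a (not necessarily dense) linear subspace of $\mathfrak H$; $\mathfrak t[\varphi]=\mathfrak t[\varphi,\varphi]$. It is semibounded if there is $c\in\mathbb R$ with $\mathfrak t[\varphi]\ge c\|\varphi\|^2$ on $\operatorname{dom}\mathfrak t$; the greatest such $c$ is the lower bound $m(\mathfrak t)\in\mathbb R$ (so $\operatorname{dom}\mathfrak t\ne\{0\}$ is understood). $\varphi_n\to_{\mathfrak t}\varphi$ means $\varphi_n\in\operatorname{dom}\mathfrak t$, $\varphi_n\to\varphi$ in $\mathfrak H$ and $\mathfrak t[\varphi_n-\varphi_m]\to0$. The form is closable if $\varphi_n\to_{\mathfrak t}0$ implies $\mathfrak t[\varphi_n]\to0$, and closed if $\varphi_n\to_{\mathfrak t}\varphi$ implies $\varphi\in\operatorname{dom}\mathfrak t$ and $\mathfrak t[\varphi_n-\varphi]\to0$; the closure of a closable semibounded form is its smallest closed extension. A linear relation $T$ from $\mathfrak H$ to $\mathfrak K$ is a linear subspace of $\mathfrak H\times\mathfrak K$; operators are identified with their graphs. $\operatorname{dom}T=\{f:\{f,g\}\in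 T\text{ for some }g\}$, $\operatorname{mul}T=\{g:\{0,g\}\in T\}$. The adjoint is $T^*=\{\{k,h\}\in\mathfrak K\times\mathfrak H:(h,f)=(k,g)\text{ for all }\{f,g\}\in T\}$, and $T^{**}$ is the closure of $T$. $RT=\{\{f,h\}:\{f,g\}\in T,\{g,h\}\in R\text{ for some }g\}$; $T+c=\{\{f,g+cf\}:\{f,g\}\in T\}$. A relation $T$ in $\mathfrak H$ is symmetric if $T\subset T^*$ and selfadjoint if $T=T^*$. Relations associated with a semibounded form $\mathfrak s$ in $\mathfrak H$ (used for $\mathfrak s=\mathfrak t$ and $\mathfrak s=\mathfrak r$): $S_{\mathfrak s}$ is the largest symmetric relation in $\mathfrak H$ with $\operatorname{dom}S_{\mathfrak s}\subset\operatorname{dom}\mathfrak s$ such that for each $\{\varphi,\varphi'\}\in S_{\mathfrak s}$ one has $\mathfrak s[\varphi,\psi]=(\varphi',\psi)$ for all $\psi\in\operatorname{dom}\mathfrak s$. $\widetilde A_{\mathfrak s}$ is the unique selfadjoint relation in $\mathfrak H$ such that for each $\{\varphi,\varphi'\}\in\widetilde A_{\mathfrak s}$ there is a sequence $\varphi_n\in\operatorname{dom}\mathfrak s$ with $\varphi_n\to_{\mathfrak s}\varphi$ and $\mathfrak s[\varphi_n,\psi]\to(\varphi',\psi)$ for all $\psi\in\operatorname{dom}\mathfrak s$. If $R$ is a representing map for $\mathfrak s-a$ with $a\le m(\mathfrak s)$ (i.e. $\operatorname{dom}R=\operatorname{dom}\mathfrak s$ and $\mathfrak s[\varphi,\psi]-a(\varphi,\psi)=(R\varphi,R\psi)$),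 then $S_{\mathfrak s}=R^*R+a$ and $\widetilde A_{\mathfrak s}=R^*R^{**}+a$. For a closed semibounded form $\mathfrak s$, $A_{\mathfrak s}$ is the unique selfadjoint relation in $\mathfrak H$ with $\operatorname{dom}A_{\mathfrak s}\subset\operatorname{dom}\mathfrak s$ and $\mathfrak s[\varphi,\psi]=(\varphi',\psi)$ for all $\{\varphi,\varphi'\}\in A_{\mathfrak s}$, $\psi\in\operatorname{dom}\mathfrak s$ (first representation theorem). The regular part $\mathfrak t_{\rm reg}$ of $\mathfrak t$ is the form given by the displayed formula for $\mathfrak r$; as a form it does not depend on the choice of $c$ and $Q_c$ (it is the largest closable semibounded form below $\mathfrak t$). *)

(* Defs.v *)
From HB Require Import structures.
From mathcomp Require Import all_boot all_order all_algebra.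
From mathcomp Require Import complex.
From mathcomp Require Import all_classical all_reals.
From mathcomp Require Import topology normedtype sequences.
Set Implicit Arguments.
Unset Strict Implicit.
Unset Printing Implicit Defensive.
Import Order.TTheory GRing.Theory Num.Theory.
Import numFieldNormedType.Exports.
Local Open Scope classical_set_scope.
Local Open Scope complex_scope.
Local Open Scope ring_scope.

(* Complex Hilbert spaces. The dot products of the library are linear in the
   first argument and conjugate-linear in the second one. *)
HB.mixin Record CompleteNormedModule_isHilbert (R : realType) H
    & CompleteNormedModule R[i] H := {
  inner : {dot H for (@Num.conj R[i])};
  inner_norm : forall x : H, inner x x = `|x| ^+ 2
}.
#[short(type="hilbertType")]
HB.structure Definition Hilbert (R : realType) :=
  {H of CompleteNormedModule R[i] H & CompleteNormedModule_isHilbert R H}.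

Notation "''[' x , y ]" := (inner x y) : ring_scope.

Definition subspace (K : pzRingType) (V : lmodType K) (A : set V) : Prop :=
  A 0 /\ forall (a : K) (x y : V), A x -> A y -> A (a *: x + y).

Section LinearRelations.
Variables (R : realType) (H K L : hilbertType R).
Implicit Types (T : set (H * K)).

Definition rdom T : set H := [set f | exists g, T (f, g)].

Definition rmul T : set K := [set g | T (0, g)].

Definition is_operator T : Prop := subspace T /\ rmul T = [set 0].

(* The value at f of an operator given by its graph; it is meaningful only for
   f in the domain. *)
Definition app T (f : H) : K := xget 0 [set g | T (f, g)].

Definition graph (F : H -> K) : set (H * K) := [set p | p.2 = F p.1].

Definition adjoint T : set (K * H) :=
  [set kh | forall f g, T (f, g) -> '[kh.2, f] = '[kh.1, g]].

Definition rcomp (S : set (K * L)) T : set (H * L) :=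
  [set fh | exists2 g, T (fh.1, g) & S (g, fh.2)].

Definition rel_shift (T : set (H * H)) (c : R) : set (H * H) :=
  [set p | exists2 g, T (p.1, g) & p.2 = g + c%:C *: p.1].

(* xget returns the nearest point, which exists as soon as the subspace M is
   closed. *)
Definition orth_proj (M : set K) (k : K) : K :=
  xget 0 [set p | M p /\ forall m, M m -> '[k - p, m] = 0].

End LinearRelations.

Definition symmetric_rel (R : realType) (H : hilbertType R) (T : set (H * H)) :
  Prop := subspace T /\ T `<=` adjoint T.

Definition selfadjoint (R : realType) (H : hilbertType R) (T : set (H * H)) :
  Prop := T = adjoint T.

Definition regular_op (R : realType) (H K : hilbertType R) (T : set (H * K)) :
    set (H * K) :=
  rcomp (graph (fun k => k - orth_proj (rmul (adjoint (adjoint T))) k)) T.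

(* Only the values of a form on its domain are meaningful; the predicates below
   never look at the other ones. *)
Record sesqform (R : realType) (H : hilbertType R) := SesqForm {
  fdom : set H;
  fval :> H -> H -> R[i] }.

Section Forms.
Variables (R : realType) (H : hilbertType R).
Implicit Types (s t : sesqform H).

Definition sesquilinear t : Prop :=
  [/\ subspace (fdom t),
      forall a x y z, fdom t x -> fdom t y -> fdom t z ->
        t (a *: x + y) z = a * t x z + t y z &
      forall a x y z, fdom t x -> fdom t y -> fdom t z ->
        t z (a *: x + y) = a^* * t z x + t z y].

(* For complex numbers z <= w means that w - z is a nonnegative real; in
   particular the values of a semibounded form on the diagonal are real. *)
Definition is_lower_bound t (c : R) : Prop :=
  forall x, fdom t x -> c%:C * `|x| ^+ 2 <= t x x.

Definition semibounded t : Prop :=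
  sesquilinear t /\ exists c, is_lower_bound t c.

Definition lower_bound t : R := sup [set c | is_lower_bound t c].

Definition form_cvg t (u : nat -> H) (x : H) : Prop :=
  [/\ forall n, fdom t (u n),
      u n @[n --> \oo] --> x &
      t (u nm.1 - u nm.2) (u nm.1 - u nm.2) @[nm --> (\oo, \oo)]
        --> (0 : R[i]^o)].

Definition form_closable t : Prop :=
  forall u, form_cvg t u 0 -> t (u n) (u n) @[n --> \oo] --> (0 : R[i]^o).

Definition form_closed t : Prop :=
  forall u x, form_cvg t u x ->
    fdom t x /\ t (u n - x) (u n - x) @[n --> \oo] --> (0 : R[i]^o).

Definition form_extension s t : Prop :=
  fdom s `<=` fdom t /\ forall x y, fdom s x -> fdom s y -> s x y = t x y.

Definition is_form_closure s t : Prop :=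
  [/\ semibounded t, form_closed t, form_extension s t &
      forall t', semibounded t' -> form_closed t' -> form_extension s t' ->
        form_extension t t'].

(* Q is a representing map for t - c. *)
Definition representing_map (K : hilbertType R) t (c : R) (Q : set (H * K)) :
    Prop :=
  [/\ is_operator Q, rdom Q = fdom t &
      forall x y f g, Q (x, f) -> Q (y, g) ->
        t x y = c%:C * '[x, y] + '[f, g]].

Definition op_form (K : hilbertType R) (c : R) (Q : set (H * K)) : sesqform H :=
  SesqForm (rdom Q) (fun x y => c%:C * '[x, y] + '[app Q x, app Q y]).

(* The relations below are definite descriptions; the default value set0 of
   xget is not a linear relation, so that it cannot be confused with a genuine
   solution. *)

Definition S_property s (S : set (H * H)) : Prop :=
  [/\ symmetric_rel S, rdom S `<=` fdom s &
      forall x x', S (x, x') -> forall y, fdom s y -> s x y = '[x', y]].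

Definition S_rel s : set (H * H) :=
  xget set0 [set S | S_property s S /\
                     forall S', S_property s S' -> S' `<=` S].

Definition Atilde_property s (A : set (H * H)) : Prop :=
  selfadjoint A /\
  forall x x', A (x, x') -> exists2 u, form_cvg s u x &
    forall y, fdom s y -> s (u n) y @[n --> \oo] --> ('[x', y] : R[i]^o).

Definition Atilde_rel s : set (H * H) :=
  xget set0 [set A | unique (Atilde_property s) A].

Definition A_property s (A : set (H * H)) : Prop :=
  [/\ selfadjoint A, rdom A `<=` fdom s &
      forall x x', A (x, x') -> forall y, fdom s y -> s x y = '[x', y]].

Definition A_rel s : set (H * H) :=
  xget set0 [set A | unique (A_property s) A].

End Forms.

(* Main.v *)
(** The relation [Q^* Q^**] is selfadjoint for every linear relation [Q] (von
    Neumann): it is symmetric, and projecting [(h, 0)] onto the closure of [Q]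
    in [H * K] shows that [Q^* Q^** + 1] is onto.  Since an inclusion between
    selfadjoint relations is an equality, it is enough to compare the relations
    attached to [t], [r] and [rbar] in one direction.  For [t] and [r], if
    [(x, k)] is in [Q^**] and [(k, h)] is in [Q^*], then [k] is orthogonal to
    [mul Q^**], hence [(x, k)] lies in [Qreg^**] and [(k, h)] in [Qreg^*].
    Finally [S_r] is the restriction of [Atilde_t] to the domain of [t], so it
    depends on [t] only. *)
Require Import Defs.
From mathcomp Require Import all_boot all_order all_algebra.
From mathcomp Require Import complex.
From mathcomp Require Import all_classical all_reals.
From mathcomp Require Import topology normedtype sequences.
From mathcomp Require Import ring lra.
Import Order.TTheory GRing.Theory Num.Theory.
Import numFieldNormedType.Exports.
Local Open Scope classical_set_scope.
Local Open Scope ring_scope.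
Set Implicit Arguments.
Unset Strict Implicit.
Unset Printing Implicit Defensive.
(* [subspace] would otherwise denote the subspace topology. *)
Local Notation subspace := Defs.subspace.

(** * Limits in normed modules and in the complex numbers *)

Lemma cvg0_sqnorm (K : numFieldType) (V : normedModType K) (T : Type)
    (F : set_system T) {FF : Filter F} (f : T -> V) :
  (`|f x| ^+ 2 @[x --> F] --> (0 : K^o)) <-> f @ F --> (0 : V).
Proof.
split=> [h|h].
  apply/cvgr0Pnorm_lt => e e0; move/cvgr0Pnorm_lt: h => /(_ (e ^+ 2)).
  rewrite exprn_gt0// => /(_ isT); apply: filterS => x.
  by rewrite normrX normr_id ltr_pXn2r// ?nnegrE// ltW.
have h1 : `|f x| @[x --> F] --> `|0 : V| by exact: cvg_norm.
have := cvgM h1 h1; rewrite normr0 mulr0.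
suff -> : (fun x => `|f x| ^+ 2) = (fun x => `|f x|) \* (fun x => `|f x|).
  by move/(_ FF).
by apply/funext => x; rewrite expr2.
Qed.

(** Form values are combinations of inner products. Since [h] and [l] are given by equations, such a
    limit reduces to two algebraic identities. *)
Lemma cvg_scalar_comb (K : numFieldType) (T : Type) (F : set_system T)
    {FF : Filter F} (k : K) (f g h : T -> K^o) (a b l : K) :
  h =1 (fun n => f n + k * g n) -> l = a + k * b ->
  f @ F --> (a : K^o) -> g @ F --> (b : K^o) -> h @ F --> (l : K^o).
Proof.
move=> /funext -> -> fa gb; apply: cvgD => //; apply: cvgM => //.
exact: cvg_cst.
Qed.
Arguments cvg_scalar_comb {K T F FF} k {f g h a b l}.

Lemma cvg_Re (R : realType) (u : nat -> R[i]^o) (z : R[i]) :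
  u n @[n --> \oo] --> (z : R[i]^o) ->
  complex.Re (u n) @[n --> \oo] --> complex.Re z.
Proof.
move=> /cvgrPdist_lt h; apply/cvgrPdist_lt => e e0.
have /h : 0 < (e%:C)%C :> R[i] by rewrite ltcR.
apply: filterS => n hn; rewrite -raddfB /= -ltcR.
by apply: le_lt_trans hn; exact: normc_ge_Re.
Qed.

(** * Algebra of the inner product *)

Section Inner.
Variables (R : realType) (H : hilbertType R).
Implicit Types x y z : H.

Lemma innerC x y : '[x, y] = '[y, x]^* :> R[i].
Proof. by rewrite hermC expr0 mul1r. Qed.

Lemma innerDl x y z : '[x + y, z] = '[x, z] + '[y, z] :> R[i].
Proof. exact: linearDl. Qed.
Lemma innerNl x y : '[- x, y] = - '[x, y] :> R[i].
Proof. exact: linearNl. Qed.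
Lemma innerBl x y z : '[x - y, z] = '[x, z] - '[y, z] :> R[i].
Proof. exact: linearBl. Qed.
Lemma innerZl a x y : '[a *: x, y] = a * '[x, y] :> R[i].
Proof. exact: linearZl_LR. Qed.
Lemma inner0l x : '[0, x] = 0 :> R[i].
Proof. exact: linear0l. Qed.
Lemma innerDr x y z : '[x, y + z] = '[x, y] + '[x, z] :> R[i].
Proof. exact: linearDr. Qed.
Lemma innerNr x y : '[x, - y] = - '[x, y] :> R[i].
Proof. exact: linearNr. Qed.
Lemma innerBr x y z : '[x, y - z] = '[x, y] - '[x, z] :> R[i].
Proof. exact: linearBr. Qed.
Lemma innerZr a x y : '[x, a *: y] = a^* * '[x, y] :> R[i].
Proof. exact: linearZr_LR. Qed.
Lemma inner0r x : '[x, 0] = 0 :> R[i].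
Proof. exact: linear0r. Qed.

Lemma inner_ge0 x : 0 <= '[x, x] :> R[i].
Proof. by rewrite inner_norm exprn_ge0. Qed.

Lemma inner_eq0 x : '[x, x] = 0 :> R[i] -> x = 0.
Proof.
by rewrite inner_norm => /eqP; rewrite expf_eq0/= normr_eq0 => /eqP.
Qed.

End Inner.

Lemma cvg0_sqnorm_le (K : numFieldType) (V : normedModType K) (T : Type)
    (F : set_system T) {FF : Filter F} (f : T -> V) (g : T -> K^o) :
  (forall x, `|f x| ^+ 2 <= g x) -> g @ F --> (0 : K^o) -> f @ F --> (0 : V).
Proof.
move=> fg /cvgr0Pnorm_lt h; apply/cvg0_sqnorm; apply/cvgr0Pnorm_lt => e /h.
apply: filterS => x; apply: le_lt_trans.
by rewrite !ger0_norm ?(le_trans _ (fg x))// exprn_ge0.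
Qed.

Lemma cvg0_subr (K : numFieldType) (V : normedModType K) (T : Type)
    (F : set_system T) {FF : Filter F} (f : T -> V) (l : V) :
  f @ F --> l <-> f x - l @[x --> F] --> (0 : V).
Proof.
split=> [h|h].
  by rewrite -(subrr l); apply: cvgB h _; exact: cvg_cst.
have -> : f = (fun x => f x - l + l) by apply/funext => x; rewrite subrK.
by rewrite -[X in _ --> X]add0r; apply: cvgD h _; exact: cvg_cst.
Qed.

(** Polarization: [z = 1] shows that [p + r] is real, and [z = 'i] that [p - r] is purely imaginary.
    For a form, [a] and [b] are the diagonal values and [p] and [r] the mixed ones. *)
Lemma conj_of_real_form (C : numClosedFieldType) (a b p r : C) :
  a^* = a -> b^* = b ->
  (forall z, let w := z * z^* * a + z * p + z^* * r + b in w^* = w) -> r = p^*.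
Proof.
move=> ra rb real.
have E z : z^* * p^* + z * r^* = z * p + z^* * r.
  have /eqP := real z; rewrite /= !(rmorphD, rmorphM) /= ra rb !conjCK.
  rewrite -subr_eq0 => /eqP h.
  by apply/eqP; rewrite -subr_eq0; apply/eqP; rewrite -{}h; ring.
have E1 := E 1; have Ei := E 'i.
rewrite conjC1 in E1; rewrite conjCi in Ei.
have {}Ei : 'i * (r^* - p^* - (p - r)) = 0.
  have -> : 'i * (r^* - p^* - (p - r)) =
    - 'i * p^* + 'i * r^* - ('i * p + - 'i * r) by ring.
  by rewrite Ei subrr.
move/eqP: Ei; rewrite mulf_eq0 (negPf (neq0Ci _))/= => /eqP Ei.
suff : r *+ 2 = p^* *+ 2 by move/eqP; rewrite eqrMn2r => /eqP.
have -> : r *+ 2 = p^* *+ 2 + (r^* - p^* - (p - r))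
  - (1 * p^* + 1 * r^* - (1 * p + 1 * r)) by ring.
by rewrite Ei E1 subrr subr0 addr0.
Qed.

Lemma conj_real (R : realType) (c : R) : (c%:C%C : R[i])^* = c%:C%C.
Proof. by apply/CrealP; rewrite complex_real. Qed.

(** * Semibounded forms: hermitian symmetry and a Cauchy-Schwarz bound *)

Definition form_shift (R : realType) (H : hilbertType R) (s : sesqform H)
  (c : R) (x y : H) : R[i] := s x y - c%:C%C * '[x, y].

Section FormTheory.
Variables (R : realType) (H : hilbertType R) (s : sesqform H) (c : R).
Hypothesis sS : sesquilinear s.
Hypothesis sc : is_lower_bound s c.
Local Notation q := (form_shift s c).
Local Notation D := (fdom s).

Lemma form_shift_ge0 x : D x -> 0 <= q x x.
Proof. by move=> /sc; rewrite /form_shift inner_norm subr_ge0. Qed.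

Lemma form_shiftPl a x y z : D x -> D y -> D z ->
  q (a *: x + y) z = a * q x z + q y z.
Proof.
case: sS => _ sl _ Dx Dy Dz.
rewrite /form_shift sl// innerDl innerZl; ring.
Qed.

Lemma form_shiftPr a x y z : D x -> D y -> D z ->
  q z (a *: x + y) = a^* * q z x + q z y.
Proof.
case: sS => _ _ sr Dx Dy Dz.
rewrite /form_shift sr// innerDr innerZr; ring.
Qed.

Lemma fdom_comb a x y : D x -> D y -> D (a *: x + y).
Proof. by case: sS => -[_ +] _ _; apply. Qed.

Lemma form_shiftC x y : D x -> D y -> q y x = (q x y)^*.
Proof.
move=> Dx Dy.
have real z : D z -> (q z z)^* = q z z.
  by move=> Dz; apply/CrealP; rewrite ger0_real// form_shift_ge0.
apply: (conj_of_real_form (real _ Dx) (real _ Dy)) => z.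
have Dz := fdom_comb z Dx Dy.
suff -> : z * z^* * q x x + z * q x y + z^* * q y x + q y y =
    q (z *: x + y) (z *: x + y) by exact: real.
by rewrite form_shiftPl// !form_shiftPr//; ring.
Qed.

Lemma form_hermitian x y : D x -> D y -> s y x = (s x y)^*.
Proof.
move=> Dx Dy; have := form_shiftC Dx Dy.
by rewrite /form_shift rmorphB rmorphM /= conj_real -innerC => /addIr.
Qed.

(* Weaker than Cauchy-Schwarz, but it needs no case distinction on [q y y]. *)
Lemma form_shift_CS x y : D x -> D y -> `|q x y| ^+ 2 <= q x x * (q y y + 1).
Proof.
move=> Dx Dy.
set b := q y y + 1; set Z := q x y.
have b_ge0 := form_shift_ge0 Dy.
have b0 : 0 < b by rewrite ltr_wpDl.
have bR : b^* = b by apply/CrealP; rewrite ger0_real// ltW.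
(* At this vector [b] times the value of [q] is [b * q x x - |Z|^2 - |Z|^2 / b]; that it is
   nonnegative is more than the claim. *)
have Dz : D (- (Z / b) *: y + x) by exact: fdom_comb.
have := form_shift_ge0 Dz.
rewrite form_shiftPl// !form_shiftPr// (form_shiftC Dx Dy) -/Z.
rewrite rmorphN rmorphM fmorphV /= bR -[q y y](addrK 1) -/b => h.
rewrite -subr_ge0.
have -> : q x x * b - `|Z| ^+ 2 =
    b * (- (Z / b) * (- (Z^* / b) * (b - 1) + Z^*) +
         (- (Z^* / b) * Z + q x x)) + `|Z| ^+ 2 / b.
  by rewrite normCK; field; rewrite gt_eqF.
by rewrite addr_ge0 ?mulr_ge0 ?exprn_ge0 ?invr_ge0 ?(ltW b0)//.
Qed.

End FormTheory.

(** * Continuity of the inner product and of semibounded forms *)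

Section InnerCvg.
Variables (R : realType) (H : hilbertType R).

(** The inner product is treated as a form with lower bound 0, so that [form_shift_CS] applies to
    it. *)
Definition inner_form : sesqform H := SesqForm setT (fun x y : H => '[x, y]).

Lemma inner_CS (x y : H) :
  `|'[x, y] : R[i]| ^+ 2 <= `|x| ^+ 2 * (`|y| ^+ 2 + 1).
Proof.
have S : sesquilinear inner_form.
  split=> // *; first by rewrite /= innerDl innerZl.
  by rewrite /= innerDr innerZr.
have B : is_lower_bound inner_form 0.
  by move=> z _ /=; rewrite inner_norm rmorph0 mul0r exprn_ge0.
have := form_shift_CS (x := x) (y := y) S B I I.
by rewrite /form_shift rmorph0 !mul0r !subr0 /= !inner_norm.
Qed.

Lemma cvg_inner (T : Type) (F : set_system T) {FF : Filter F}
    (u v : T -> H) x y :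
  u @ F --> x -> v @ F --> y ->
  '[u n, v n] @[n --> F] --> ('[x, y] : R[i]^o).
Proof.
move=> /cvg0_subr ux /cvg0_subr vy.
(* It suffices that the first factor vanishes in the limit: the second one converges, so the bound
   of [inner_CS] tends to 0. *)
have small (f g : T -> H) (k : H) : f @ F --> (0 : H) -> g @ F --> k ->
    ('[f n, g n] : R[i]^o) @[n --> F] --> (0 : R[i]^o).
  move=> /cvg0_sqnorm f0 gk.
  apply: (cvg0_sqnorm_le (f := fun n => '[f n, g n] : R[i]^o)
    (fun n => inner_CS (f n) (g n))).
  rewrite -(mul0r (`|k| ^+ 2 + 1 : R[i])); apply: cvgM f0 _.
  apply: cvgD; last exact: cvg_cst.
  under eq_fun do rewrite expr2.
  have h : `|g x| @[x --> F] --> `|k| by exact: cvg_norm.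
  by rewrite expr2; exact: cvgM.
apply/cvg0_subr.
(* The conjugate moves the vanishing factor [v n - y] to the first argument, where [small]
   applies. *)
have -> : (fun n => '[u n, v n] - '[x, y] : R[i]^o) =
    (fun n => '[u n - x, v n] + ('[v n - y, x])^*).
  apply/funext => n; rewrite -innerC innerBl innerBr; ring.
rewrite -(addr0 0); apply: cvgD.
  by apply: (small _ _ y) => //; apply/cvg0_subr.
apply/cvg0_sqnorm; under eq_fun do rewrite norm_conjC.
apply/cvg0_sqnorm; apply: (small _ _ x) => //; exact: cvg_cst.
Qed.

End InnerCvg.

(** By [form_shift_CS] the shifted form at [u n - x] and [y] tends to 0; the term removed by the
    shift converges by continuity of the inner product. *)
Lemma form_cvg_left (R : realType) (H : hilbertType R) (s : sesqform H) (c : R)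
    (u : nat -> H) (x y : H) :
  sesquilinear s -> is_lower_bound s c ->
  (forall n, fdom s (u n)) -> fdom s x -> fdom s y ->
  u n @[n --> \oo] --> x ->
  s (u n - x) (u n - x) @[n --> \oo] --> (0 : R[i]^o) ->
  s (u n) y @[n --> \oo] --> (s x y : R[i]^o).
Proof.
move=> sS sc Du Dx Dy ux sux.
have Dux n : fdom s (u n - x).
  by rewrite addrC -scaleN1r; exact: (fdom_comb sS).
move: (ux) => /cvg0_subr u0.
have q0 : form_shift s c (u n - x) (u n - x) @[n --> \oo] --> (0 : R[i]^o).
  apply: (cvg_scalar_comb (- c%:C%C) _ _ sux (cvg_inner u0 u0)) => [n|].
    by rewrite mulNr.
  by rewrite inner0l mulr0 addr0.
have qy0 : (form_shift s c (u n - x) y : R[i]^o) @[n --> \oo] --> (0 : R[i]^o).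
  apply: (cvg0_sqnorm_le (f := fun n => form_shift s c (u n - x) y : R[i]^o)
    (fun n => form_shift_CS sS sc (Dux n) Dy)).
  apply: (cvg_scalar_comb (form_shift s c y y) _ _ q0 q0) => [n|]; ring.
apply/(@cvg0_subr _ (R[i]^o)).
apply: (cvg_scalar_comb c%:C%C _ _ qy0 (cvg_inner u0 (cvg_cst y))) => [n|].
  rewrite /form_shift subrK.
  by case: sS => _ h _; rewrite [u n - x]addrC -[- x]scaleN1r h// mulN1r addrC.
by rewrite inner0l mulr0 addr0.
Qed.

(** The double limit is the shape in which [form_cvg] expresses the Cauchy property; completeness
    provides the limit. *)
Lemma cvg_of_sqnorm_diff (K : numFieldType) (V : completeNormedModType K)
    (u : nat -> V) :
  (`|u nm.1 - u nm.2| ^+ 2 @[nm --> (\oo, \oo)] --> (0 : K^o)) ->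
  exists l : V, u @ \oo --> l.
Proof.
move=> /cvg0_sqnorm /cvgr0Pnorm_lt h.
suff : cauchy (u @ \oo) by move/cauchy_cvg => C; exists (lim (u @ \oo)).
rewrite -cauchy_ballP => e /h he.
by rewrite !near_simpl/= -ball_normE; exact: he.
Qed.

Lemma cvg_diff_00 (K : numFieldType) (V : normedModType K) (u : nat -> V)
    (l : V) :
  u @ \oo --> l -> u nm.1 - u nm.2 @[nm --> (\oo, \oo)] --> (0 : V).
Proof.
move=> ul; rewrite -(subrr l); apply: cvgB.
  by apply: cvg_comp ul; exact: cvg_fst.
by apply: cvg_comp ul; exact: cvg_snd.
Qed.

Lemma cvg_real_complex (R : realType) (T : Type) (F : set_system T)
    {FF : Filter F} (f : T -> R) (l : R) :
  f @ F --> l -> ((f x)%:C%C : R[i]^o) @[x --> F] --> (l%:C%C : R[i]^o).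
Proof.
move=> /cvgrPdist_lt h; apply/cvgrPdist_lt => e e0.
(* A positive element of [R[i]] is real, so the tolerance can be taken in [R]. *)
have re : (complex.Re e)%:C%C = e by rewrite RRe_real// gtr0_real.
have /h : 0 < complex.Re e by rewrite -ltcR re.
apply: filterS => x hx; rewrite -rmorphB /= -re normc_def /= expr0n addr0.
by rewrite sqrtr_sqr ltcR.
Qed.

(** * Squared norms as real numbers *)

Section Sqn.
Variables (R : realType) (H : hilbertType R).
Implicit Types x y : H.

(** A value in [R] rather than [R[i]], because the projection argument takes an infimum of squared
    distances. *)
Definition sqn x : R := complex.Re ('[x, x] : R[i]).

Lemma sqnE x : '[x, x] = (sqn x)%:C%C :> R[i].
Proof. by rewrite RRe_real// inner_norm realX// normr_real. Qed.

Lemma sqn_ge0 x : 0 <= sqn x.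
Proof. by rewrite -lecR -sqnE inner_norm exprn_ge0. Qed.

Lemma sqnorm_sqn x : `|x| ^+ 2 = (sqn x)%:C%C.
Proof. by rewrite -sqnE inner_norm. Qed.

Lemma sqn_parallelogram x y :
  sqn (x - y) + sqn (x + y) = sqn x *+ 2 + sqn y *+ 2.
Proof.
apply: (@complexI R); rewrite !(rmorphD, rmorphMn) /= -!sqnE.
rewrite !(innerBl, innerBr, innerDl, innerDr); ring.
Qed.

Lemma sqnMn x n : sqn (x *+ n) = sqn x * (n ^ 2)%:R.
Proof.
apply: (@complexI R); rewrite rmorphM rmorph_nat /= -!sqnE -scaler_nat.
by rewrite innerZl innerZr conjC_nat natrX; ring.
Qed.

Lemma sqnC x y : sqn (x - y) = sqn (y - x).
Proof. by rewrite -opprB /sqn innerNl innerNr opprK. Qed.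

Lemma cvg_sqn (u : nat -> H) x :
  u @ \oo --> x -> sqn (u n) @[n --> \oo] --> sqn x.
Proof. by move=> ux; exact: cvg_Re (cvg_inner ux ux). Qed.

End Sqn.

Section Subspaces.
Variables (R : realType) (H K : hilbertType R) (T : set (H * K)).
Hypothesis TS : subspace T.

Lemma rel0 : T (0, 0). Proof. exact: (proj1 TS). Qed.

Lemma rel_comb a x y x' y' :
  T (x, y) -> T (x', y') -> T (a *: x + x', a *: y + y').
Proof. exact: (proj2 TS a (x, y) (x', y')). Qed.

Lemma rel_sub x y x' y' : T (x, y) -> T (x', y') -> T (x - x', y - y').
Proof.
move=> Txy Txy'; have := rel_comb (-1) Txy' Txy.
by rewrite !scaleN1r ![- _ + _]addrC.
Qed.

Lemma rel_scale a x y : T (x, y) -> T (a *: x, a *: y).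
Proof. by move=> Txy; have := rel_comb a Txy rel0; rewrite !addr0. Qed.

End Subspaces.

(** * Orthogonal projection onto the closure of a linear relation *)

Section Projection.
Variables (R : realType) (H K : hilbertType R) (T : set (H * K)).
Hypothesis TS : subspace T.

(** Variational argument in [H * K]: moving the residual [(a, b)] along [(x, y)] cannot shorten
    it. *)
Lemma nearest_orthogonal (a : H) (b : K) :
  (forall x y, T (x, y) -> forall z : R[i],
     sqn a + sqn b <= sqn (a - z *: x) + sqn (b - z *: y)) ->
  forall x y, T (x, y) -> '[a, x] + '[b, y] = 0 :> R[i].
Proof.
move=> min x y Txy.
set Z := '[a, x] + '[b, y].
(* [B] is the squared norm of [(x, y)] plus 1, hence invertible. The choice [z = Z / B] changes the
   squared distance by [- |Z|^2 * (B + 1) / B^2], which forces [Z = 0]. *)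
set B := (sqn x)%:C%C + (sqn y)%:C%C + 1 : R[i].
have B0 : 0 < B by rewrite ltr_wpDl// addr_ge0 // lecR sqn_ge0.
have BR : B^* = B by apply/CrealP; rewrite ger0_real// ltW.
have := min _ _ Txy (Z / B).
rewrite -lecR !rmorphD /= -!sqnE.
rewrite !(innerBl, innerBr, innerZl, innerZr).
rewrite ![ '[x, a] ]innerC ![ '[y, b] ]innerC.
rewrite -subr_ge0 rmorphM /= fmorphV /= BR !sqnE.
have -> : (sqn x)%:C%C = B - 1 - (sqn y)%:C%C :> R[i] by rewrite /B; ring.
have -> : '[b, y] = Z - '[a, x] :> R[i] by rewrite /Z; ring.
rewrite rmorphB /= => h.
suff : `|Z| ^+ 2 <= 0.
  by rewrite -normrX normr_le0 expf_eq0 => /andP[_ /eqP].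
move: h; set E := (X in 0 <= X).
have -> : E = - (`|Z| ^+ 2 * ((B + 1) / B ^+ 2)).
  by rewrite /E normCK; field; rewrite gt_eqF.
by rewrite oppr_ge0 pmulr_lle0// divr_gt0 ?exprn_gt0// addr_gt0//.
Qed.

(** Parallelogram law in both components: the midpoint of two points of [T] is again in [T], so its
    squared distance to [(h, k)] is at least [d]. *)
Lemma minimizing_cauchy (h : H) (k : K) (d : R) (u : nat -> H) (v : nat -> K) :
  (forall x y, T (x, y) -> d <= sqn (h - x) + sqn (k - y)) ->
  (forall n, T (u n, v n)) ->
  (forall n, sqn (h - u n) + sqn (k - v n) <= d + n.+1%:R^-1) ->
  forall n m, sqn (u n - u m) + sqn (v n - v m) <=
    n.+1%:R^-1 *+ 2 + m.+1%:R^-1 *+ 2.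
Proof.
move=> lb Tuv near_d n m.
have Tmid : T (2^-1 *: (u n + u m), 2^-1 *: (v n + v m)).
  have T2 := rel_comb TS 2^-1 (Tuv n) (rel0 TS); rewrite !addr0 in T2.
  have := rel_comb TS 2^-1 (Tuv m) T2.
  by rewrite -!scalerDr addrC [v m + _]addrC.
have half (V : hilbertType R) (e x y : V) :
    sqn (x - y) + sqn (e - 2^-1 *: (x + y)) * 4 =
    sqn (e - x) *+ 2 + sqn (e - y) *+ 2.
  rewrite -(sqn_parallelogram (e - x) (e - y)) -(sqnMn _ 2).
  have -> : (e - 2^-1 *: (x + y)) *+ 2 = e - x + (e - y).
    rewrite mulrnBl -[(2^-1 *: _) *+ 2]scaler_nat scalerA divff ?pnatr_eq0//.
    by rewrite scale1r mulr2n opprD addrACA.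
  have -> : e - x - (e - y) = y - x by rewrite opprB addrC addrA subrK.
  by rewrite sqnC.
have := lb _ _ Tmid; have := near_d n; have := near_d m.
have := half _ h (u n) (u m); have := half _ k (v n) (v m).
by rewrite !mulr2n; move: (n.+1%:R^-1) (m.+1%:R^-1) => a b *; lra.
Qed.

(** The point [(f, g)] of the closure of [T] nearest to [(h, k)] is the limit of a minimizing
    sequence. The sequence is kept in the conclusion, since [T] need not contain [(f, g)]. *)
Lemma projection (h : H) (k : K) : exists u v (f : H) (g : K),
  [/\ forall n, T (u n, v n), u @ \oo --> f, v @ \oo --> g &
    forall x y, T (x, y) -> '[h - f, x] + '[k - g, y] = 0 :> R[i]].
Proof.
pose E := [set sqn (h - xy.1) + sqn (k - xy.2) | xy in T].
have hE : has_inf E.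
  split.
    by exists (sqn (h - 0) + sqn (k - 0)), (0, 0); first exact: (rel0 TS).
  by exists 0 => _ [xy _ <-]; rewrite addr_ge0 ?sqn_ge0.
have lb x y : T (x, y) -> inf E <= sqn (h - x) + sqn (k - y).
  by move=> Txy; apply: (ge_inf hE.2); exists (x, y).
have /choice[w w_near] (n : nat) : exists xy, T xy /\
    sqn (h - xy.1) + sqn (k - xy.2) <= inf E + n.+1%:R^-1.
  have /inf_adherent/(_ hE)[_ [xy Txy <-] /ltW le] : 0 < n.+1%:R^-1 :> R.
    by rewrite invr_gt0 ltr0n.
  by exists xy.
pose u n := (w n).1; pose v n := (w n).2.
have Tuv n : T (u n, v n) by rewrite -surjective_pairing; have [] := w_near n.
have near_d n : sqn (h - u n) + sqn (k - v n) <= inf E + n.+1%:R^-1.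
  by have [] := w_near n.
have small := minimizing_cauchy lb Tuv near_d.
have harm : ((nm.1.+1%:R^-1 *+ 2 + nm.2.+1%:R^-1 *+ 2)%:C%C : R[i]^o)
    @[nm --> (\oo, \oo)] --> (0 : R[i]^o).
  rewrite -[0]/((0 : R)%:C%C); apply: cvg_real_complex.
  have h0 : (n.+1%:R^-1 *+ 2 : R) @[n --> \oo] --> (0 : R).
    by rewrite -(mul0rn R 2); apply: cvgMn; exact: cvg_harmonic.
  rewrite -(addr0 (0 : R)); apply: cvgD.
    exact: (cvg_comp fst (fun n => n.+1%:R^-1 *+ 2 : R) cvg_fst h0).
  exact: (cvg_comp snd (fun n => n.+1%:R^-1 *+ 2 : R) cvg_snd h0).
have [f uf] : exists f : H, u @ \oo --> f.
  apply/cvg_of_sqnorm_diff/cvg0_sqnorm.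
  apply: (cvg0_sqnorm_le _ harm) => -[n m] /=.
  by rewrite sqnorm_sqn lecR (le_trans _ (small n m))// lerDl sqn_ge0.
have [g vg] : exists g : K, v @ \oo --> g.
  apply/cvg_of_sqnorm_diff/cvg0_sqnorm.
  apply: (cvg0_sqnorm_le _ harm) => -[n m] /=.
  by rewrite sqnorm_sqn lecR (le_trans _ (small n m))// lerDr sqn_ge0.
exists u, v, f, g; split=> //; apply: nearest_orthogonal => x y Txy z.
(* Minimality of the limit is obtained by comparing both sides with [inf E] for each [n]: the left
   one through [near_d], the right one because [(u n + z *: x, v n + z *: y)] lies in [T]. *)
apply: (@ler_cvg_to _ \oo _ R
  (fun n => sqn (h - u n) + sqn (k - v n) - harmonic n)
  (fun n => sqn (h - u n - z *: x) + sqn (k - v n - z *: y))).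
- rewrite -[X in _ --> X]subr0; apply: cvgB (cvg_harmonic).
  by apply: cvgD; apply: cvg_sqn; apply: cvgB => //; exact: cvg_cst.
- apply: cvgD; apply: cvg_sqn; apply: cvgB; (try exact: cvg_cst).
    by apply: cvgB => //; exact: cvg_cst.
  by apply: cvgB => //; exact: cvg_cst.
- apply: nearW => n; rewrite lerBlDr (le_trans (near_d n))// lerD2r.
  rewrite -!addrA -!opprD ![_ + z *: _]addrC.
  exact: lb (rel_comb TS z Txy (Tuv n)).
Qed.

End Projection.

(** * Adjoints and closures of linear relations *)

Section Adjoint.
Variables (R : realType) (H K : hilbertType R).
Implicit Types T : set (H * K).

Lemma adjointS T T' : T `<=` T' -> adjoint T' `<=` adjoint T.
Proof. by move=> TT' [k h] adj f g /TT'; exact: adj. Qed.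

Lemma sub_adjoint2 T : T `<=` adjoint (adjoint T).
Proof.
by move=> [x y] Txy f g /(_ _ _ Txy)/= fg; rewrite innerC -fg -innerC.
Qed.

Lemma adjoint_subspace T : subspace (adjoint T).
Proof.
split=> [f g _|a [k h] [k' h'] adj adj' f g Tfg] /=; first by rewrite !inner0l.
by rewrite !innerDl !innerZl (adj _ _ Tfg) (adj' _ _ Tfg).
Qed.

Lemma adjoint_closed T (u : nat -> K) (v : nat -> H) x y :
  (forall n, adjoint T (u n, v n)) -> u @ \oo --> x -> v @ \oo --> y ->
  adjoint T (x, y).
Proof.
move=> adj ux vy f g Tfg /=.
apply: (@cvg_unique _ (@norm_hausdorff _ (R[i]^o)) ('[v n, f] @[n --> \oo])).
  exact: cvg_inner vy (cvg_cst f).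
have E n : '[v n, f] = '[u n, g] := adj n _ _ Tfg.
rewrite /= (funext E).
exact: cvg_inner ux (cvg_cst g).
Qed.

(** The pair [(0, m)] of [T^**] is tested against [(k, h)]. *)
Lemma rmul_orthogonal T (k : K) h m :
  adjoint T (k, h) -> rmul (adjoint (adjoint T)) m -> '[k, m] = 0 :> R[i].
Proof.
by move=> adj /(_ _ _ adj)/=; rewrite inner0l => E; rewrite innerC E conjC0.
Qed.

End Adjoint.

Section AdjointClosure.
Variables (R : realType) (H K : hilbertType R).
Implicit Types T : set (H * K).

(** The residual [(h - f, k - g)] is orthogonal to [T]; swapping its entries and changing one sign
    turns orthogonality into membership in [T^*]. *)
Lemma rel_projection T h k : subspace T -> exists f g,
  adjoint (adjoint T) (f, g) /\ adjoint T (k - g, - (h - f)).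
Proof.
move=> TS; have [u [v [f [g [Tuv uf vg orth]]]]] := projection TS h k.
exists f, g; split.
  by apply: adjoint_closed _ uf vg => n; exact: sub_adjoint2.
move=> x y Txy /=; have := orth _ _ Txy.
by move/eqP; rewrite addr_eq0 innerNl => /eqP ->; rewrite opprK.
Qed.

(** The residual of the projection of [(x, k)] lies in [T^**] and, after the swap, in [T^*]. Pairing
    it with itself shows that it vanishes. *)
Lemma adjoint2_closure T x k : subspace T -> adjoint (adjoint T) (x, k) ->
  exists u v, [/\ forall n, T (u n, v n), u @ \oo --> x & v @ \oo --> k].
Proof.
move=> TS adjxk; have [u [v [f [g [Tuv uf vg orth]]]]] := projection TS x k.
have adjfg : adjoint (adjoint T) (f, g).
  by apply: adjoint_closed _ uf vg => n; exact: sub_adjoint2.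
have adj : adjoint T (k - g, - (x - f)).
  move=> a b Tab /=; have := orth _ _ Tab.
  by move/eqP; rewrite addr_eq0 innerNl => /eqP ->; rewrite opprK.
have /(_ _ _ adj) := rel_sub (adjoint_subspace _) adjxk adjfg.
rewrite /= innerNr => /eqP; rewrite -addr_eq0 paddr_eq0 ?inner_ge0//.
move=> /andP[/eqP/inner_eq0 kg /eqP/inner_eq0 xf].
by exists u, v; split=> //; [rewrite (subr0_eq xf)|rewrite (subr0_eq kg)].
Qed.

End AdjointClosure.

Lemma adjoint3 (R : realType) (H K : hilbertType R) (T : set (H * K)) :
  adjoint (adjoint (adjoint T)) = adjoint T.
Proof.
apply/seteqP; split; last exact: sub_adjoint2.
by apply: adjointS; exact: sub_adjoint2.
Qed.

(** * Selfadjoint relations *)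

Section Selfadjoint.
Variables (R : realType) (H : hilbertType R).

Lemma selfadjoint_eq (A B : set (H * H)) :
  selfadjoint A -> selfadjoint B -> A `<=` B -> A = B.
Proof.
move=> sA sB AB; apply/seteqP; split=> //.
by rewrite sA sB; exact: adjointS.
Qed.

Lemma rel_shiftE (A : set (H * H)) c x x' :
  rel_shift A c (x, x') <-> A (x, x' - c%:C%C *: x).
Proof.
split=> [[g /= Ag ->]|Ag]; first by rewrite addrK.
by exists (x' - c%:C%C *: x) => //=; rewrite subrK.
Qed.

(** As [c] is real, it contributes the same term to both sides of the adjoint identity. *)
Lemma selfadjoint_shift (A : set (H * H)) c :
  selfadjoint A -> selfadjoint (rel_shift A c).
Proof.
move=> sA; apply/seteqP; split=> -[x x'].
  move=> /rel_shiftE Ax f g /rel_shiftE Af /=; rewrite sA in Ax.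
  have := Ax _ _ Af; rewrite /= innerBl innerBr innerZl innerZr.
  by rewrite conj_real => /addIr.
move=> adj; apply/rel_shiftE; rewrite sA => f g Af /=.
have /adj /= : rel_shift A c (f, g + c%:C%C *: f).
  by apply/rel_shiftE; rewrite addrK.
by rewrite innerDr innerBl innerZr innerZl conj_real => ->; rewrite addrK.
Qed.

End Selfadjoint.

Lemma selfadjoint_adjoint_comp (R : realType) (H K : hilbertType R)
    (T : set (H * K)) :
  subspace T -> selfadjoint (rcomp (adjoint T) (adjoint (adjoint T))).
Proof.
move=> TS; set A := rcomp _ _.
have symA : A `<=` adjoint A.
  move=> [x h] [k /= Txk Tkh] y h' [k' /= Tyk' Tkh'].
  by rewrite -(Txk _ _ Tkh') innerC -(Tyk' _ _ Tkh) /= -innerC.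
apply/seteqP; split=> // -[x x'] adj.
have range h : exists y, A (y, h - y).
  (* The projection gives [(- g, - (h - y))] in [T^*]; scaling by -1 makes it composable with
     [(y, g)]. *)
  have [y [g [Tyg]]] := rel_projection h 0 TS.
  rewrite sub0r => /(rel_scale (adjoint_subspace T) (-1)).
  by rewrite !scaleN1r !opprK => Tgh; exists y, g.
(* The target is [x = y]. Subtracting [(y, x' + x - y)] from [(x, x')] puts [(x - y, - (x - y))] in
   [A^*]; testing it against [(z, x - y - z)] in [A] yields ['[x - y, x - y] = 0]. *)
have [y Ay] := range (x' + x).
have [z Az] := range (x - y).
have /(_ _ _ Az) := rel_sub (adjoint_subspace A) adj (symA _ Ay).
have -> : x' - (x' + x - y) = - (x - y).
  by rewrite !opprD !opprK !addrA addrN add0r.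
rewrite /= innerNl innerBr => /eqP; rewrite eq_sym subr_eq addNr.
move=> /eqP/inner_eq0/eqP; rewrite subr_eq0 => /eqP xy.
by move: Ay; rewrite -xy addrK.
Qed.

(** * Operators given by graphs, and sums and products of relations *)

Section Operators.
Variables (R : realType) (H K : hilbertType R) (Q : set (H * K)).
Hypothesis Qop : is_operator Q.

Lemma op_inj x f g : Q (x, f) -> Q (x, g) -> f = g.
Proof.
case: Qop => QS Qm Qf Qg; apply/subr0_eq.
have := rel_sub QS Qf Qg; rewrite subrr => h.
by have : rmul Q (f - g) by []; rewrite Qm.
Qed.

Lemma app_op x f : Q (x, f) -> app Q x = f.
Proof. by move=> Qf; apply: xget_unique => // g /op_inj; apply. Qed.

Lemma rdom_app x : rdom Q x -> Q (x, app Q x).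
Proof. by case=> f Qf; rewrite (app_op Qf). Qed.

Lemma op_form_rep c : representing_map (op_form c Q) c Q.
Proof. by split=> // x y f g Qf Qg /=; rewrite (app_op Qf) (app_op Qg). Qed.

End Operators.

Lemma xget_uniqueP (T : choiceType) (x0 x : T) (P : T -> Prop) :
  unique P x -> xget x0 [set y | unique P y] = x.
Proof.
by move=> ux; apply: xget_unique => // y [Py _]; case: ux => _ /(_ _ Py).
Qed.

Lemma rcomp_subspace (R : realType) (H K L : hilbertType R)
    (T : set (H * K)) (S : set (K * L)) :
  subspace T -> subspace S -> subspace (rcomp S T).
Proof.
move=> TS SS; split; first by exists 0; [exact: (rel0 TS)|exact: (rel0 SS)].
move=> b [x z] [x' z'] [y Ty Sy] [y' Ty' Sy'].
by exists (b *: y + y'); [exact: (rel_comb TS)|exact: (rel_comb SS)].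
Qed.

Lemma rel_shift_subspace (R : realType) (H : hilbertType R)
    (T : set (H * H)) (c : R) :
  subspace T -> subspace (rel_shift T c).
Proof.
move=> TS; split.
  by exists 0; [exact: (rel0 TS)|rewrite /= scaler0 addr0].
move=> b [x z] [x' z'] /rel_shiftE Tx /rel_shiftE Tx'; apply/rel_shiftE.
have := rel_comb TS b Tx Tx'; congr (T (_, _)) => /=.
by rewrite scalerBr scalerDr !scalerA mulrC opprD addrACA.
Qed.

(** * Forms with a representing map *)

Section RepresentingMap.
Variables (R : realType) (H K : hilbertType R) (s : sesqform H) (a : R)
  (Q : set (H * K)).
Hypothesis Qs : representing_map s a Q.

Let Qop : is_operator Q. Proof. by case: Qs. Qed.
Let QS : subspace Q. Proof. by case: Qop. Qed.
Let domQ : rdom Q = fdom s. Proof. by case: Qs. Qed.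
Let sE x y f g : Q (x, f) -> Q (y, g) -> s x y = a%:C%C * '[x, y] + '[f, g].
Proof. by case: Qs => _ _; apply. Qed.

Lemma rep_sesquilinear : sesquilinear s.
Proof.
rewrite /sesquilinear -domQ; split.
- split=> [|b x y [f Qf] [g Qg]]; first by exists 0; exact: (rel0 QS).
  by exists (b *: f + g); exact: rel_comb.
- move=> b x y z [f Qf] [g Qg] [k Qk].
  rewrite (sE (rel_comb QS b Qf Qg) Qk) (sE Qf Qk) (sE Qg Qk).
  by rewrite !innerDl !innerZl; ring.
- move=> b x y z [f Qf] [g Qg] [k Qk].
  rewrite (sE Qk (rel_comb QS b Qf Qg)) (sE Qk Qf) (sE Qk Qg).
  by rewrite !innerDr !innerZr; ring.
Qed.

Lemma rep_lower_bound : is_lower_bound s a.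
Proof.
move=> x; rewrite -domQ => -[f Qf].
by rewrite (sE Qf Qf) inner_norm lerDl inner_ge0.
Qed.

Lemma rep_semibounded : semibounded s.
Proof.
by split; [exact: rep_sesquilinear|exists a; exact: rep_lower_bound].
Qed.

(** The squared norm of [v n - v m] is the value of [s - a] at [u n - u m], so the images under [Q]
    are Cauchy. With [form_cvg_rep], convergence for the form amounts to convergence in the graph of
    [Q]. *)
Lemma rep_form_cvg u x : form_cvg s u x ->
  exists v (k : K), (forall n, Q (u n, v n)) /\ v @ \oo --> k.
Proof.
case=> Du ux suu.
have Qu n : Q (u n, app Q (u n)) by apply: rdom_app => //; rewrite domQ.
suff [k vk] : exists k : K, app Q (u n) @[n --> \oo] --> k.
  by exists (fun n => app Q (u n)), k.
have uu := cvg_diff_00 ux.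
apply: cvg_of_sqnorm_diff.
apply: (cvg_scalar_comb (- a%:C%C) _ _ suu (cvg_inner uu uu)) => [[n m]|] /=.
  have Qnm := rel_sub QS (Qu n) (Qu m).
  by rewrite (sE Qnm Qnm) -inner_norm; ring.
by rewrite inner0l mulr0 addr0.
Qed.

Lemma form_cvg_rep u v x (k : K) : (forall n, Q (u n, v n)) ->
  u @ \oo --> x -> v @ \oo --> k -> form_cvg s u x.
Proof.
move=> Quv ux vk; split=> //; first by move=> n; rewrite -domQ; exists (v n).
have uu := cvg_diff_00 ux; have vv := cvg_diff_00 vk.
apply: (cvg_scalar_comb a%:C%C _ _ (cvg_inner vv vv) (cvg_inner uu uu))
  => [[n m]|] /=.
  have Qnm := rel_sub QS (Quv n) (Quv m).
  by rewrite (sE Qnm Qnm) addrC.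
by rewrite !inner0l mulr0 addr0.
Qed.

Lemma S_rel_rep : S_rel s = rel_shift (rcomp (adjoint Q) Q) a.
Proof.
set B := rel_shift _ _.
have Bval x x' y : B (x, x') -> fdom s y -> s x y = '[x', y].
  move=> /rel_shiftE[/= f Qf adj]; rewrite -domQ => -[g Qg].
  by rewrite (sE Qf Qg) -(adj _ _ Qg) /= innerBl innerZl addrC subrK.
have Bdom x x' : B (x, x') -> fdom s x.
  by move=> /rel_shiftE[/= f Qf _]; rewrite -domQ; exists f.
have BP : S_property s B.
  split=> [|x [x' /Bdom]//|x x' Bx y]; last exact: Bval.
  split.
    apply: rel_shift_subspace; apply: rcomp_subspace => //.
    exact: adjoint_subspace.
  move=> [x x'] Bx y y' By /=.
  have Dx := Bdom _ _ Bx; have Dy := Bdom _ _ By.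
  rewrite -(Bval _ _ _ Bx Dy).
  rewrite (form_hermitian rep_sesquilinear rep_lower_bound Dy Dx).
  by rewrite (Bval _ _ _ By Dx) -innerC.
(* For [f] the image of [x], the identity [s x y = '[x', y]] says exactly that [(f, x' - a x)] lies
   in [Q^*]. *)
have Bmax S : S_property s S -> S `<=` B.
  move=> [_ domS Sval] [x x'] Sx; apply/rel_shiftE.
  have : fdom s x by apply: domS; exists x'.
  rewrite -domQ => -[f Qf]; exists f => //= y g Qg /=.
  have := Sval _ _ Sx y; rewrite -domQ => /(_ (ex_intro _ g Qg)).
  by rewrite (sE Qf Qg) innerBl innerZl => <-; rewrite addrC addKr.
apply: xget_unique => // S [SP Smax].
by apply/seteqP; split; [exact: Bmax|exact: Smax].
Qed.

Lemma Atilde_rel_rep :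
  Atilde_rel s = rel_shift (rcomp (adjoint Q) (adjoint (adjoint Q))) a.
Proof.
set B := rel_shift _ _.
have sB : selfadjoint B.
  by apply: selfadjoint_shift; exact: selfadjoint_adjoint_comp.
apply: xget_uniqueP; split.
  split=> // x x' /rel_shiftE[/= k Qk adj].
  have [u [v [Quv ux vk]]] := adjoint2_closure QS Qk.
  exists u; first exact: form_cvg_rep Quv ux vk.
  rewrite -domQ => y [g Qg].
  apply: (cvg_scalar_comb a%:C%C _ _ (cvg_inner vk (cvg_cst g))
    (cvg_inner ux (cvg_cst y))) => [n|].
    by rewrite (sE (Quv n) Qg) addrC.
  by rewrite -(adj _ _ Qg) /= innerBl innerZl subrK.
(* For uniqueness only [A] inside [B] has to be shown. The intermediate vector is the limit [k] of
   the images of the approximating sequence, and the adjoint identity comes from two limits of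
   ['[v n, g]]. *)
move=> A [sA AP]; apply/esym/selfadjoint_eq => // -[x x'] /AP[u sux sulim].
have [v [k [Quv vk]]] := rep_form_cvg sux.
have [_ ux _] := sux.
apply/rel_shiftE; exists k => /=.
  apply: adjoint_closed _ ux vk => n; exact: sub_adjoint2.
move=> y g Qg /=; rewrite innerBl innerZl.
have Dy : fdom s y by rewrite -domQ; exists g.
apply: (@cvg_unique _ (@norm_hausdorff _ (R[i]^o)) ('[v n, g] @[n --> \oo])).
  apply: (cvg_scalar_comb (- a%:C%C) _ _ (sulim _ Dy)
    (cvg_inner ux (cvg_cst y))) => [n|]; last by rewrite mulNr.
  by rewrite (sE (Quv n) Qg); ring.
exact: cvg_inner vk (cvg_cst g).
Qed.

(** The images of a sequence that converges to 0 for the form have their limit in [mul Q^**]. *)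
Lemma rep_closable : rmul (adjoint (adjoint Q)) = [set 0] -> form_closable s.
Proof.
move=> mul0 u su; have [v [k [Quv vk]]] := rep_form_cvg su.
have [_ u0 _] := su.
have : rmul (adjoint (adjoint Q)) k.
  by apply: adjoint_closed _ u0 vk => n; exact: sub_adjoint2.
rewrite mul0 => /= k0; rewrite k0 in vk.
apply: (cvg_scalar_comb a%:C%C _ _ (cvg_inner vk vk) (cvg_inner u0 u0)) => [n|].
  by rewrite (sE (Quv n) (Quv n)) addrC.
by rewrite !inner0l mulr0 addr0.
Qed.

Hypothesis Qclosed : adjoint (adjoint Q) = Q.

Lemma A_rel_rep : A_rel s = rel_shift (rcomp (adjoint Q) Q) a.
Proof.
set B := rel_shift _ _.
have sB : selfadjoint B.
  (* For closed [Q] the product [Q^* Q] is [Q^* Q^**]. *)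
  apply: selfadjoint_shift; rewrite -{2}Qclosed.
  exact: selfadjoint_adjoint_comp.
apply: xget_uniqueP; split.
  split=> // [x [x' /rel_shiftE[/= f Qf _]]|]; first by rewrite -domQ; exists f.
  move=> x x' /rel_shiftE[/= f Qf adj] y; rewrite -domQ => -[g Qg].
  by rewrite (sE Qf Qg) -(adj _ _ Qg) /= innerBl innerZl addrC subrK.
move=> A [sA Adom Aval]; apply/esym/selfadjoint_eq => // -[x x'] Ax.
apply/rel_shiftE.
have : fdom s x by apply: Adom; exists x'.
rewrite -domQ => -[f Qf]; exists f => //= y g Qg /=.
have Dy : fdom s y by rewrite -domQ; exists g.
have := Aval _ _ Ax _ Dy.
by rewrite (sE Qf Qg) innerBl innerZl => <-; rewrite addrC addKr.
Qed.

Lemma rep_closed : form_closed s.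
Proof.
move=> u x su; have [v [k [Quv vk]]] := rep_form_cvg su.
have [_ ux _] := su.
have Qxk : Q (x, k).
  rewrite -Qclosed; apply: adjoint_closed _ ux vk => n; exact: sub_adjoint2.
split; first by rewrite -domQ; exists k.
move: ux vk => /cvg0_subr ux /cvg0_subr vk.
apply: (cvg_scalar_comb a%:C%C _ _ (cvg_inner vk vk) (cvg_inner ux ux)) => [n|].
  have Qn := rel_sub QS (Quv n) Qxk.
  by rewrite (sE Qn Qn) addrC.
by rewrite !inner0l mulr0 addr0.
Qed.

End RepresentingMap.

(** For minimality, a sequence in the graph of [Q] converging to a point of [Q^**] converges for
    [r], hence for every closed extension [t] of [r]. So [t] contains the limit, and its values
    there are limits of values of [r]. *)
Lemma rep_closure (R : realType) (H K : hilbertType R) (r rbar : sesqform H)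
    (a : R) (Q : set (H * K)) :
  representing_map r a Q -> representing_map rbar a (adjoint (adjoint Q)) ->
  is_form_closure r rbar.
Proof.
move=> rQ rbQ.
have QQb : Q `<=` adjoint (adjoint Q) by exact: sub_adjoint2.
have Qbc : adjoint (adjoint (adjoint (adjoint Q))) = adjoint (adjoint Q).
  by rewrite adjoint3.
have [[QS _] domr rE] := rQ.
have [_ domrb rbE] := rbQ.
have ext : form_extension r rbar.
  split=> [x|x y]; rewrite -?domr -?domrb => -[f Qf].
    by exists f; exact: QQb.
  case=> g Qg; rewrite (rE _ _ _ _ Qf Qg).
  by rewrite (rbE _ _ _ _ (QQb _ Qf) (QQb _ Qg)).
have rbs := rep_semibounded rbQ.
split=> //; first exact: rep_closed rbQ Qbc.
move=> t [tS [c tc]] tcl [Drt rt].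
have approx x : fdom rbar x -> exists u, [/\ forall n, fdom r (u n), fdom t x,
    forall y, fdom t y -> t (u n) y @[n --> \oo] --> (t x y : R[i]^o) &
    forall y, fdom rbar y -> rbar (u n) y @[n --> \oo] --> (rbar x y : R[i]^o)].
  move=> Dx; have [k Qk] : rdom (adjoint (adjoint Q)) x by rewrite domrb.
  have [u [v [Quv ux vk]]] := adjoint2_closure QS Qk.
  have [Du _ ruu] := form_cvg_rep rQ Quv ux vk.
  have Duu n m : fdom r (u n - u m).
    by rewrite -domr; exists (v n - v m); exact: rel_sub.
  have tu : form_cvg t u x.
    split=> // [n|]; first exact: Drt.
    suff -> : (fun nm : nat * nat => t (u nm.1 - u nm.2) (u nm.1 - u nm.2)) =
      (fun nm : nat * nat => r (u nm.1 - u nm.2) (u nm.1 - u nm.2)) by [].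
    by apply/funext => nm; rewrite rt.
  have [Dtx tux] := tcl _ _ tu.
  have Qbuv n := QQb _ (Quv n).
  have [_ rux] := rep_closed rbQ Qbc (form_cvg_rep rbQ Qbuv ux vk).
  exists u; split; [exact: Du|exact: Dtx|move=> y Dy|move=> y Dy].
    exact: (form_cvg_left tS tc (fun n => Drt _ (Du n)) Dtx Dy ux tux).
  exact: (form_cvg_left (rep_sesquilinear rbQ) (rep_lower_bound rbQ)
    (fun n => ext.1 _ (Du n)) Dx Dy ux rux).
have limE (u v : nat -> R[i]) (l m : R[i]) : u =1 v ->
    u @ \oo --> (l : R[i]^o) -> v @ \oo --> (m : R[i]^o) -> l = m.
  by move=> /funext ->; exact: (@cvg_unique _ (@norm_hausdorff _ (R[i]^o))).
(* Only the first argument passes to the limit here, the second staying in the domain of [r].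
   Hermitian symmetry then frees the other argument. *)
have half y x : fdom rbar y -> fdom r x -> rbar y x = t y x.
  move=> /approx[u [Du Dy tu ru]] Dx.
  apply: limE (ru _ (ext.1 _ Dx)) (tu _ (Drt _ Dx)) => n /=.
  by rewrite -ext.2// rt.
split=> [x /approx[u []//]|x y Dx Dy].
have [u [Du Dtx tu ru]] := approx _ Dx.
have [_ [_ Dty _ _]] := approx _ Dy.
apply: limE (ru _ Dy) (tu _ Dty) => n /=.
rewrite (form_hermitian (rep_sesquilinear rbQ) (rep_lower_bound rbQ) Dy
  (ext.1 _ (Du n))).
by rewrite (form_hermitian tS tc Dty (Drt _ (Du n))) half.
Qed.

(** * The regular part of an operator *)

Section RegularPart.
Variables (R : realType) (H K : hilbertType R) (Q : set (H * K)).
Hypothesis Qop : is_operator Q.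
Let QS : subspace Q. Proof. by case: Qop. Qed.
Local Notation M := (rmul (adjoint (adjoint Q))).
Local Notation Qreg := (regular_op Q).

Let M0 : M 0. Proof. exact: (rel0 (adjoint_subspace _)). Qed.
Let MB m m' : M m -> M m' -> M (m - m').
Proof.
move=> Mm Mm'; have := rel_sub (adjoint_subspace _) Mm Mm'.
by rewrite subrr.
Qed.
Let MZD b m m' : M m -> M m' -> M (b *: m + m').
Proof.
move=> Mm Mm'; have := rel_comb (adjoint_subspace _) b Mm Mm'.
by rewrite scaler0 addr0.
Qed.

(** Excludes the default value of [xget]: [M] is the multivalued part of a closed relation, so the
    nearest point exists. *)
Lemma orth_projP k :
  M (orth_proj M k) /\ forall m, M m -> '[k - orth_proj M k, m] = 0 :> R[i].
Proof.
suff [p Pp] : exists p, M p /\ forall m, M m -> '[k - p, m] = 0 :> R[i].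
  pose P := [set p | M p /\ forall m, M m -> '[k - p, m] = 0 :> R[i]].
  exact: (xgetPex 0 (ex_intro P p Pp)).
(* Viewing [M] as the relation [{0} x M] makes [projection] applicable. *)
pose T0 := [set xy : H * K | xy.1 = 0 /\ M xy.2].
have T0S : subspace T0.
  split=> [|b [x y] [x' y'] [/= -> My] [/= -> My']]; first by split.
  by split=> /=; [rewrite scaler0 addr0|exact: MZD].
have [u [v [f [g [T0uv uf vg orth]]]]] := projection T0S 0 k.
exists g; split=> [|m Mm].
  have Mv n : adjoint (adjoint Q) (0, v n) by have [_] := T0uv n.
  exact: (adjoint_closed Mv (cvg_cst _) vg).
by have := orth 0 m (conj erefl Mm); rewrite inner0r add0r.
Qed.

(** Splitting [f] into a part in [M] and a part orthogonal to [M] is unique, so [orth_proj] can be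
    avoided from here on in most arguments. *)
Lemma regular_opE x g : Qreg (x, g) <->
  exists f, [/\ Q (x, f), M (f - g) & forall m, M m -> '[g, m] = 0 :> R[i]].
Proof.
split=> [[f /= Qf]|[f [Qf Mfg gM]]]; have [MP PM] := orth_projP f.
  rewrite /graph /= => ->.
  by exists f; split=> //; rewrite opprB addrC subrK.
exists f => //=; apply/subr0_eq/inner_eq0.
set p := orth_proj M f in MP PM *.
have Mgp : M (g - (f - p)).
  rewrite (_ : g - (f - p) = p - (f - g)); first exact: MB.
  by rewrite !opprB addrCA.
by rewrite innerBl gM// PM// subrr.
Qed.

Lemma rdom_regular : rdom Qreg = rdom Q.
Proof.
apply/seteqP; split=> x [f]; first by case=> g Qg _; exists g.
by move=> Qf; exists (f - orth_proj M f), f.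
Qed.

Lemma regular_operator : is_operator Qreg.
Proof.
split.
  split.
    apply/regular_opE; exists 0; rewrite subr0; split=> //.
      exact: (rel0 QS).
    by move=> m _; rewrite inner0l.
  move=> b [x g] [x' g'].
  move=> /regular_opE[f [Qf Mf gM]] /regular_opE[f' [Qf' Mf' gM']].
  apply/regular_opE; exists (b *: f + f'); split; first exact: (rel_comb QS).
    by rewrite opprD addrACA -scalerBr; exact: MZD.
  by move=> m Mm; rewrite innerDl innerZl gM// gM'// mulr0 addr0.
apply/seteqP; split=> [g /regular_opE[f [Qf Mfg gM]]|_ ->] /=.
  have f0 : f = 0 by apply: (op_inj Qop Qf); exact: (rel0 QS).
  apply: inner_eq0; apply: gM.
  by have := MB M0 Mfg; rewrite f0 !sub0r opprK.
apply/regular_opE; exists 0; rewrite subr0; split=> //; first exact: (rel0 QS).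
by move=> m _; rewrite inner0l.
Qed.

(** The values of [Q] and [Qreg] differ by elements of [M], which are orthogonal to the domain of
    [Q^*]. *)
Lemma adjoint_regular : adjoint Q `<=` adjoint Qreg.
Proof.
move=> [k h] adj x g /regular_opE[f [Qf Mfg gM]] /=.
rewrite (adj _ _ Qf) /= -(subrK g f) innerDr.
by rewrite (rmul_orthogonal adj Mfg) add0r.
Qed.

(** The range of [Qreg] is orthogonal to [M], so [(m, 0)] belongs to [Qreg^*]. *)
Lemma adjoint2_regular_orthogonal x k m :
  adjoint (adjoint Qreg) (x, k) -> M m -> '[k, m] = 0 :> R[i].
Proof.
move=> adj Mm; have /adj /= -> : adjoint Qreg (m, 0); last by rewrite inner0r.
move=> y g /regular_opE[f [_ _ gM]] /=.
by rewrite inner0l innerC gM// conjC0.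
Qed.

(** By [adjoint_regular], [Qreg^**] is contained in [Q^**]; its multivalued part thus lies in [M]
    and is also orthogonal to [M]. *)
Lemma rmul_adjoint2_regular : rmul (adjoint (adjoint Qreg)) = [set 0].
Proof.
apply/seteqP; split=> [k Qk|_ -> /=]; last exact: (rel0 (adjoint_subspace _)).
apply: inner_eq0; apply: (adjoint2_regular_orthogonal Qk).
exact: (adjointS adjoint_regular) Qk.
Qed.

Lemma adjoint2_regular_comp x k h :
  adjoint (adjoint Q) (x, k) -> adjoint Q (k, h) ->
  adjoint (adjoint Qreg) (x, k).
Proof.
move=> Qxk Qkh k' h' adj /=.
have [MP PM] := orth_projP k'; set p := orth_proj M k' in MP PM.
(* Removing the [M] component of [k'] turns a pair of [Qreg^*] into one of [Q^*]. Since [k] is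
   orthogonal to [p], the pairing with [k] is unchanged. *)
have : adjoint Q (k' - p, h').
  move=> y f Qf /=; have [MPf PMf] := orth_projP f.
  have Qregf : Qreg (y, f - orth_proj M f) by exists f.
  have pf : '[p, f - orth_proj M f] = 0 :> R[i] by rewrite innerC PMf// conjC0.
  have fE : '[k' - p, f - orth_proj M f] = '[k' - p, f] :> R[i].
    by rewrite innerBr (PM _ MPf) subr0.
  by rewrite (adj _ _ Qregf) /= -fE innerBl pf subr0.
by move=> /Qxk /= <-; rewrite innerBr (rmul_orthogonal Qkh MP) subr0.
Qed.

(** A value [k] of [Q] in the domain of [Q^*] is orthogonal to [M], hence already a value of
    [Qreg]. *)
Lemma S_sub_regular :
  rcomp (adjoint Q) Q `<=` rcomp (adjoint Qreg) Qreg.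
Proof.
move=> [x h] [k /= Qk adj]; exists k => /=; last exact: adjoint_regular.
apply/regular_opE; exists k; rewrite subrr; split=> // m Mm.
exact: rmul_orthogonal adj Mm.
Qed.

Lemma Atilde_regular :
  rcomp (adjoint Q) (adjoint (adjoint Q)) =
  rcomp (adjoint Qreg) (adjoint (adjoint Qreg)).
Proof.
apply: selfadjoint_eq; try apply: selfadjoint_adjoint_comp => //.
  by case: regular_operator.
move=> [x h] [k /= Qk adj]; exists k => /=; last exact: adjoint_regular.
exact: adjoint2_regular_comp Qk adj.
Qed.

End RegularPart.

(** On the domain of [Q] the operator [Q^**] takes the same values as [Q]. *)
Lemma rel_shift_comp_restrict (R : realType) (H K : hilbertType R)
    (Q : set (H * K)) (c : R) :
  is_operator Q -> is_operator (adjoint (adjoint Q)) ->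
  rel_shift (rcomp (adjoint Q) Q) c =
  rel_shift (rcomp (adjoint Q) (adjoint (adjoint Q))) c `&`
    [set p | rdom Q p.1].
Proof.
move=> Qop Qbop; apply/seteqP; split=> -[x x'].
  move=> /rel_shiftE[/= k Qk adj]; split; last by exists k.
  by apply/rel_shiftE; exists k => //=; exact: sub_adjoint2.
move=> [/rel_shiftE[/= k Qk adj] [f Qf]]; apply/rel_shiftE; exists k => //=.
by rewrite (op_inj Qbop Qk (sub_adjoint2 Qf)).
Qed.

(** * The relations attached to a form, its regular part and the closure *)

Section Main.
Variables (R : realType) (H K : hilbertType R) (t : sesqform H) (c : R)
  (Q : set (H * K)).
Hypothesis tQ : representing_map t c Q.
Local Notation Qreg := (regular_op Q).
Local Notation r := (op_form c Qreg).
Local Notation rbar := (op_form c (adjoint (adjoint Qreg))).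

Lemma regular_adjoint2_operator : is_operator (adjoint (adjoint Qreg)).
Proof.
case: tQ => Qop _ _; split; first exact: adjoint_subspace.
exact: rmul_adjoint2_regular.
Qed.

Lemma regular_rep : representing_map r c Qreg.
Proof. by apply: op_form_rep; case: tQ => Qop _ _; exact: regular_operator. Qed.

Lemma regular_closure_rep : representing_map rbar c (adjoint (adjoint Qreg)).
Proof. by apply: op_form_rep; exact: regular_adjoint2_operator. Qed.

Lemma Atilde_regular_form : Atilde_rel t = Atilde_rel r.
Proof.
rewrite (Atilde_rel_rep tQ) (Atilde_rel_rep regular_rep).
by case: tQ => Qop _ _; rewrite (Atilde_regular Qop).
Qed.

Lemma Atilde_regular_closure : Atilde_rel r = A_rel rbar.
Proof.
rewrite (Atilde_rel_rep regular_rep) (A_rel_rep regular_closure_rep).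
  by rewrite adjoint3.
by rewrite adjoint3.
Qed.

Lemma S_regular_restrict :
  S_rel r = Atilde_rel t `&` [set p | fdom t p.1].
Proof.
rewrite Atilde_regular_form (Atilde_rel_rep regular_rep).
rewrite (S_rel_rep regular_rep).
rewrite rel_shift_comp_restrict.
- by rewrite rdom_regular; case: tQ => _ ->.
- by case: regular_rep.
- exact: regular_adjoint2_operator.
Qed.

End Main.

Theorem theorem6p5 (R : realType) (H K : hilbertType R) (t : sesqform H)
    (c : R) (Q : set (H * K)) :
  semibounded t ->
  (exists2 x, fdom t x & x != 0) ->
  c <= lower_bound t ->
  representing_map t c Q ->
  let Qreg := regular_op Q in
  let r := op_form c Qreg in
  let rbar := op_form c (adjoint (adjoint Qreg)) in
  [/\ [/\ semibounded r, form_closable r, fdom r = fdom t &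
          representing_map r c Qreg],
      is_form_closure r rbar /\
        representing_map rbar c (adjoint (adjoint Qreg)),
      S_rel r = rel_shift (rcomp (adjoint Qreg) Qreg) c /\
        Atilde_rel r = rel_shift (rcomp (adjoint Qreg) (adjoint (adjoint Qreg))) c,
      [/\ S_rel t `<=` S_rel r,
          Atilde_rel t = Atilde_rel r &
          Atilde_rel r = A_rel rbar] &
      forall (c' : R) (K' : hilbertType R) (Q' : set (H * K')),
        c' <= lower_bound t ->
        representing_map t c' Q' ->
        S_rel (op_form c' (regular_op Q')) = S_rel r /\
        A_rel (op_form c' (adjoint (adjoint (regular_op Q')))) = A_rel rbar].
Proof.
move=> _ _ _ tQ Qreg r rbar.
have [Qop domQ _] := tQ.
have rQ := regular_rep tQ.
have rbQ := regular_closure_rep tQ.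
split.
- split=> //; first exact: rep_semibounded rQ.
    by apply: (rep_closable rQ); exact: rmul_adjoint2_regular.
  by rewrite /= rdom_regular.
- by split=> //; exact: rep_closure rQ rbQ.
- by split; [exact: S_rel_rep rQ|exact: Atilde_rel_rep rQ].
- split; [|exact: Atilde_regular_form tQ|exact: Atilde_regular_closure tQ].
  rewrite (S_rel_rep tQ) (S_rel_rep rQ) => -[x x'] /rel_shiftE Tx.
  by apply/rel_shiftE; exact: S_sub_regular Tx.
(* Both relations are rewritten in terms of [Atilde_rel t] and the domain of [t], where neither the
   constant nor the map occurs. *)
- move=> c' K' Q' _ tQ'; split.
    by rewrite (S_regular_restrict tQ') (S_regular_restrict tQ).
  by rewrite -(Atilde_regular_closure tQ') -(Atilde_regular_closure tQ)
    -(Atilde_regular_form tQ') (Atilde_regular_form tQ).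
Qed.
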